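(* Let $Q$ be a 2-connected quiver. Consider the Stanley-Reisner ring $\mathbb Q[\Delta]$ associated to the order complex $\Delta$ of the poset $(\Pi(Q_1)\setminus\{\emptyset,Q_1\},\subseteq)$. Then $$A_Q=\frac{(1-q^{-1})^{b(Q)}}{1-q^{-b(Q)}}\cdot\mathrm{Hilb}_\Delta\left(u_E=q^{-(b(Q)-b(Q|_E))}\right),$$ and $\mathrm{Hilb}_\Delta\left(u_E=q^{-(b(Q)-b(Q|_E))}\right)$ can be presented as a rational fraction whose numerator has non-negative coefficients.
   Context: A quiver $Q=(Q_0,Q_1,s,t)$ has finite vertex set $Q_0$, finite arrow set $Q_1$ and source and target maps $s,t:Q_1\to Q_0$. $Q$ is 2-connected if its underlying graph is connected and removing any edge does not disconnect it. For a graph (or quiver) with $C$ connected components, $V$ vertices and $E$ edges the Betti number is $b=C-V+E$. For $E\subseteq Q_1$, $Q|_E$ is the quiver with vertex set $Q_0$ and arrow set $E$. $A_Q$: for $\alpha\ge1$, a prime power $q$ and $\mathcal O_\alpha=\mathbb F_q[t]/(t^\alpha)$, let $A_{(Q,\alpha),\underline1}(q)$ be the number of isomorphism classes of absolutely indecomposable, locally free representations of $Q$ over $\mathcal O_\alpha$ of rank vector $\underline1=(1,\dots,1)$; that is, the number of $(\mathcal O_\alpha^\times)^{Q_0}$-orbits, under $(g\cdot x)_a=g_{t(a)}x_ag_{s(a)}^{-1}$, on the set of $x=(x_a)\in\mathcal O_\alpha^{Q_1}$ such that the graph with vertex set $Q_0$ and edge set $\{a:x_a\ne0\}$ is connected.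 Then $A_Q(q)=\lim_{\alpha\to\infty}q^{-\alpha(1-\sharp Q_0+\sharp Q_1)}A_{(Q,\alpha),\underline1}(q)$; for $Q$ 2-connected this limit is known to exist and to be a rational fraction in $q$. $\Pi(S)$ is the poset of subsets of a set $S$ ordered by inclusion. The order complex of a finite poset $\Pi$ is the simplicial complex with vertex set $\Pi$ whose faces are the chains (totally ordered subsets, including $\emptyset$). For a simplicial complex $\Delta$ with vertices $x_1,\dots,x_n$, the Stanley-Reisner ring $\mathbb Q[\Delta]$ is the quotient of $\mathbb Q[x_1,\dots,x_n]$ by the ideal generated by the monomials $x_{i_1}\cdots x_{i_r}$ ($i_1<\dots<i_r$) with $\{x_{i_1},\dots,x_{i_r}\}\notin\Delta$; its fine Hilbert series for the natural $\mathbb Z_{\ge0}^n$-grading is $\mathrm{Hilb}_\Delta(u)=\sum_{\mathbf m}\dim\mathbb Q[\Delta]_{\mathbf m}\,u^{\mathbf m}=\sum_{F\in\Delta}\prod_{x_i\in F}\frac{u_i}{1-u_i}$. Here the vertices are the proper nonempty subsets $E$ of $Q_1$, with variables $u_E$, and $\mathrm{Hilb}_\Delta(u_E=\dots)$ denotes the specialisation of the variables $u_E$ to the given values. *)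

(* Defs.v *)
From HB Require Import structures.
From mathcomp Require Import all_boot all_order all_algebra.
From mathcomp Require Import all_classical all_reals all_analysis.
(* [mpoly] is loaded without its notations, which clash with those loaded above:
   [multinom n] is the type of monomials in [n] variables, [mpoly n K] the
   polynomial ring, [mpolyX K m] the monomial [m]. *)
From mathcomp Require mpoly.
Import -(notations) mpoly.

Set Implicit Arguments.
Unset Strict Implicit.
Unset Printing Implicit Defensive.

Import Order.TTheory GRing.Theory Num.Theory.
Import numFieldNormedType.Exports.

Local Open Scope ring_scope.

Record quiver := Quiver {
  vertex : finType;
  arrow : finType;
  src : arrow -> vertex;
  tgt : arrow -> vertex }.

Section Graphs.
Variable Q : quiver.
Implicit Types E : {set arrow Q}.

Definition adjacent E : rel (vertex Q) := fun i j =>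
  [exists a in E, ((src a == i) && (tgt a == j))
               || ((src a == j) && (tgt a == i))].

(* The graphs below all have the full vertex set [vertex Q]; [E] is the set of
   edges, so that [setT] stands for [Q] itself. *)
Definition components E : nat := n_comp (adjacent E) predT.

Definition connected_graph E : bool := components E == 1%N.

Definition two_connected : bool :=
  connected_graph [set: arrow Q] &&
  [forall a : arrow Q, connected_graph ([set: arrow Q] :\ a)%SET].

Definition betti E : int :=
  (components E)%:Z - #|vertex Q|%:Z + #|E|%:Z.

End Graphs.

Section Counting.
Variables (Q : quiver) (F : finFieldType) (alpha : nat).

(* F[t]/(t^alpha) for alpha >= 1.  (For alpha = 0 the library quotients by 'X
   instead; this does not affect limits in alpha.) *)
Local Notation trunc_ring := {poly %/ ('X^alpha : {poly F})}.
Local Notation rep := {ffun arrow Q -> trunc_ring}.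

Definition isomorphic_rep (x y : rep) : bool :=
  [exists g : {ffun vertex Q -> trunc_ring},
     [forall i, g i \is a GRing.unit] &&
     [forall a, y a == g (tgt a) * x a * (g (src a))^-1]].

Definition abs_indecomposable (x : rep) : bool :=
  connected_graph [set a | x a != 0]%SET.

Definition kac_count : nat :=
  #|[set [set y | isomorphic_rep x y]%SET | x : rep & abs_indecomposable x]%SET|.

End Counting.

Section Limit.
Variables (R : realType) (Q : quiver) (F : finFieldType).
Let q : R := #|F|%:R.

Definition normalized_count (alpha : nat) : R :=
  q ^ (- (alpha%:Z * (1 - #|vertex Q|%:Z + #|arrow Q|%:Z)))
  * (kac_count Q F alpha)%:R.

(* A_Q(q), for q the cardinality of F *)
Definition A_limit : R := limn normalized_count.

End Limit.

(* For subspaces W and I of V: the image of W in V / I has dimension d. *)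
Definition image_has_dim (K : fieldType) (V : lmodType K) (W I : set V)
    (d : nat) : Prop :=
  exists e : 'I_d -> V, (forall i, W (e i)) /\
    forall v, W v -> exists! c : {ffun 'I_d -> K}, I (v - \sum_i c i *: e i).

Section StanleyReisner.
(* A simplicial complex is given by its vertex type T and its set of faces; the
   variables of the polynomial ring are indexed by T through [enum_rank]. *)
Variables (T : finType) (Delta : {set {set T}}).

Definition SR_var (v : T) : mpoly #|T| rat := mpolyX rat (mnm1 (enum_rank v)).

Definition SR_ideal : set (mpoly #|T| rat) :=
  [set p | exists c : {set T} -> mpoly #|T| rat,
     p = \sum_(G : {set T} | G \notin Delta) c G * \prod_(v in G) SR_var v].

Definition degree_part (m : multinom #|T|) : set (mpoly #|T| rat) :=
  [set p | exists c : rat, p = c *: mpolyX rat m].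

(* dim Q[Delta]_m, with Q[Delta] = mpoly / SR_ideal *)
Definition SR_dim (m : multinom #|T|) : nat :=
  xget 0%N (image_has_dim (degree_part m) SR_ideal).

(* Value of the fine Hilbert series at a point u; the sum is an unordered sum
   of non-negative terms, and converges as soon as 0 <= u v < 1 for all v. *)
Definition Hilb (R : realType) (u : T -> R) : R :=
  fine (\esum_(m in [set: multinom #|T|])
    ((SR_dim m)%:R * \prod_(v : T) u v ^+ m (enum_rank v))%:E)%E.

End StanleyReisner.

Definition order_complex (T : finType) (le : rel T) : {set {set T}} :=
  [set G : {set T} | [forall x in G, forall y in G, le x y || le y x]]%SET.

Definition proper_nonempty (S : finType) : finType :=
  {E : {set S} | (E != finset.set0) && (E != [set: S]%SET)}.

Definition subset_complex (S : finType) : {set {set proper_nonempty S}} :=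
  order_complex (fun E E' : proper_nonempty S => val E \subset val E').

(* Hilb_Delta (u_E = q^-(b(Q) - b(Q|_E))) *)
Definition Hilb_betti (R : realType) (Q : quiver) (q : R) : R :=
  Hilb (subset_complex (arrow Q))
    (fun E => q ^ (- (betti [set: arrow Q]%SET - betti (val E)))).

(* Main.v *)
(** By Burnside's lemma the number of orbits is the sum over the connected x of
|Stab x| / |G|.  Let S_j be the set of arrows a with val(x_a) <= j.  An element g
stabilises x iff for every k the coefficients of t^k in g are constant on the
components of Q|_(S_(alpha-1-k)), so |Stab x| is a product of powers of q with
exponents the numbers of components of the S_j.  Summing over the coefficients of x
layer by layer, the normalised count becomes the sum over the multichains
S_0 <= ... <= S_(alpha-1) with S_(alpha-1) connected of
(1 - q^-1)^b(S_(alpha-1)) prod_j w(S_j), where w(E) = q^-(b(Q) - b(Q|_E)).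
Since Q is 2-connected, w(E) < 1 unless E = Q_1, so in the limit only the multichains
reaching Q_1 count: their sum is governed by the recursion
H(S) = 1 + sum_(S < E < Q_1) w(E)/(1 - w(E)) H(E), which is also satisfied by the sum
over the chains above S; and H(emptyset) is the Hilbert series.

For positivity, chains are grouped by the permutation of Q_1 they extend to (adding the
elements of each block in increasing order).  A permutation contributes #Q_1 - 1
factors, each w/(1-w) (at a descent) or 1/(1-w), so all terms acquire the common
denominator (q^M - 1)^(#Q_1 - 1), M being a common multiple of the exponents. *)
Require Import Defs.
From mathcomp Require mpoly.
Import -(notations) mpoly.
From mathcomp Require Import all_boot all_order all_algebra.
From mathcomp Require Import all_classical all_reals all_analysis.
From mathcomp Require Import zify ring lra.
Import Order.TTheory GRing.Theory Num.Theory.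
Import numFieldNormedType.Exports.
Set Implicit Arguments.
Unset Strict Implicit.
Unset Printing Implicit Defensive.
Local Open Scope ring_scope.

(** * Betti numbers *)

Section Graph_lemmas.
Variable Q : quiver.
Implicit Types (E : {set arrow Q}) (D : finType).

Lemma adjacent_sym E : symmetric (Defs.adjacent E).
Proof. by move=> i j; apply/eq_existsb => a; rewrite orbC. Qed.

Lemma adjacent_connect_sym E : connect_sym (Defs.adjacent E).
Proof. exact/sym_connect_sym/adjacent_sym. Qed.

(** These are the functions constant on the connected components of the graph with edge set [E];
    counting them is how [components] enters. *)
Definition arrow_invariant D E (h : {ffun vertex Q -> D}) :=
  [forall a in E, h (tgt a) == h (src a)].

Lemma arrow_invariant_root D E (h : {ffun vertex Q -> D}) i :
  arrow_invariant E h -> h (fingraph.root (Defs.adjacent E) i) = h i.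
Proof.
move=> hE; have /connectP[p ep ->] := connect_root (Defs.adjacent E) i.
elim: p i ep => //= j p IHp i /andP[ij /IHp ->].
have /existsP[a /andP[aE]] := ij.
have /eqP ha := forall_inP hE a aE.
by case/orP => /andP[/eqP<- /eqP<-].
Qed.

(** An invariant function is determined by its values at the component roots, and these values are
    arbitrary in [X]. *)
Lemma card_arrow_invariant D (X : {pred D}) x0 E : x0 \in X ->
  #|[set h : {ffun vertex Q -> D} | arrow_invariant E h
       && [forall i, h i \in X]]%SET| = (#|X| ^ components E)%N.
Proof.
move=> x0X; pose r := fingraph.root (Defs.adjacent E).
(* Values at the roots are kept and all others replaced by the default [x0], the normal form of the
   partial functions counted by [card_pffun_on]. *)
pose res (h : {ffun vertex Q -> D}) := [ffun i => if r i == i then h i else x0].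
rewrite -(@card_in_imset _ _ res); last first.
  move=> h h'; rewrite !inE => /andP[hE _] /andP[hE' _] /ffunP e.
  apply/ffunP=> i; rewrite -(arrow_invariant_root i hE) -(arrow_invariant_root i hE').
  by have := e (r i); rewrite !ffunE /r root_root ?eqxx //; exact: adjacent_connect_sym.
rewrite /components /n_comp_mem -(@card_pffun_on _ _ x0).
apply: eq_card => f; apply/imsetP/pffun_onP => [[h]|[f0 fX]].
  rewrite inE => /andP[hE /forallP hX] ->; split.
    apply/fintype.subsetP=> i; rewrite !inE ffunE andbT /fingraph.roots -/r.
    by case: (r i == i) => //; rewrite eqxx.
  by move=> _ /fintype.imageP[j _ ->]; rewrite ffunE; case: ifP.
have hE i : f (r i) \in X.
  apply: fX; apply/fintype.imageP; exists (r i) => //.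
  by rewrite inE /= roots_root //; exact: adjacent_connect_sym.
exists [ffun i => f (r i)].
  rewrite inE; apply/andP; split; last by apply/forallP=> i; rewrite ffunE.
  apply/forall_inP=> a aE; rewrite !ffunE; apply/eqP; congr (f _).
  apply/esym/eqP; rewrite root_connect; last exact: adjacent_connect_sym.
  by apply: connect1; apply/existsP; exists a; rewrite aE !eqxx.
apply/ffunP=> i; rewrite !ffunE; case: eqP => [->//|ri].
apply/eqP/negPn/negP=> fi; have /fintype.subsetP/(_ i) := f0.
by rewrite !inE fi /fingraph.roots andbT => /(_ isT)/eqP.
Qed.

Lemma components0 : components (finset.set0 : {set arrow Q}) = #|vertex Q|.
Proof.
apply/eqP; rewrite -(@eqn_exp2l 2) // -card_bool.
rewrite -(@card_arrow_invariant _ _ true) // -card_ffun; apply/eqP/eq_card => h.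
rewrite !inE; apply/andP; split; last by apply/forallP.
by apply/forall_inP => a; rewrite inE.
Qed.

Lemma betti0 : betti (finset.set0 : {set arrow Q}) = 0.
Proof. by rewrite /betti components0 subrr finset.cards0. Qed.

(* Over bool the invariant functions form a vector space of dimension the number of
   components, and the edge a imposes one linear condition on it. *)
Lemma components_addE E a : (components E <= (components (a |: E)%SET).+1)%N.
Proof.
pose I E' := [set h : {ffun vertex Q -> bool} | arrow_invariant E' h]%SET.
have cI E' : #|I E'| = (2 ^ components E')%N.
  rewrite -card_bool -(@card_arrow_invariant _ _ true) //; apply: eq_card => h.
  rewrite !inE; case: arrow_invariant => //=.
  by apply/esym/forallP=> i.
rewrite -(@leq_exp2l 2) // expnS -!cI.
have sub : (I (a |: E) \subset I E)%SET.
  apply/fintype.subsetP=> h; rewrite !inE => /forall_inP hE.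
  by apply/forall_inP=> b bE; apply: hE; rewrite !inE bE orbT.
have mI h : (h \in I (a |: E)%SET) = (h \in I E) && (h (tgt a) == h (src a)).
  rewrite !inE; apply/forall_inP/andP=> [H|[/forall_inP H ha] b].
    split; first by apply/forall_inP=> b bE; apply: H; rewrite !inE bE orbT.
    by apply: H; rewrite !inE eqxx.
  by rewrite !inE => /orP[/eqP->//|/H].
have -> : I E = (I (a |: E) :|: (I E :\: I (a |: E)))%SET.
  by apply/setP=> h; rewrite !inE; have := mI h; rewrite !inE;
     case: arrow_invariant; case: arrow_invariant.
apply: leq_trans (leq_card_setU _ _) _; rewrite mul2n -addnn leq_add2l.
have [->|[h0 h0I]] := set_0Vmem (I E :\: I (a |: E))%SET; first by rewrite cards0.
(* Adding [h0] maps the functions violating the condition at [a] injectively to functions satisfying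
   it. *)
pose sh (h : {ffun vertex Q -> bool}) := [ffun i => h i (+) h0 i].
rewrite -(@card_imset _ _ sh).
  apply/subset_leq_card/fintype.subsetP=> _ /imsetP[h hI ->].
  move: h0I hI; rewrite mI !finset.in_setD !mI => /andP[+ h0I] /andP[+ hI].
  rewrite h0I hI /= !ffunE => h0a ha.
  have -> : sh h \in I E.
    move: h0I hI; rewrite !inE => /forall_inP h0I /forall_inP hI.
    by apply/forall_inP=> b bE; rewrite !ffunE (eqP (hI b bE)) (eqP (h0I b bE)).
  by move: h0a ha; case: (h _); case: (h _); case: (h0 _); case: (h0 _).
move=> h h' /ffunP e; apply/ffunP=> i; have := e i; rewrite !ffunE.
by move/(congr1 (addb^~ (h0 i))); rewrite !addbK.
Qed.

(** Adding an arrow raises the edge count by one and lowers the number of components by at most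
    one. *)
Lemma betti_mono E E' : E \subset E' -> betti E <= betti E'.
Proof.
move=> sEE'.
have [n] := ubnP #|E' :\: E|%SET; elim: n => // n IHn in E sEE' *.
rewrite ltnS => leEn; have [D0|[a aD]] := set_0Vmem (E' :\: E)%SET.
  have -> : E = E' by apply/eqP; rewrite finset.eqEsubset sEE' -finset.setD_eq0 D0 eqxx.
  by [].
move: (aD); rewrite finset.in_setD => /andP[aE aE'].
have : (betti (a |: E) <= betti E').
  apply: IHn; first by rewrite finset.subUset finset.sub1set aE'.
  apply: leq_trans leEn; apply: proper_card; apply/properP; split.
    by apply: finset.setDS; apply: finset.subsetUr.
  by exists a => //; rewrite !inE eqxx.
apply: le_trans; rewrite /betti finset.cardsU1 aE.
by have := components_addE E a; lia.
Qed.

(** A subset missing [a] lies in the complement of [a], which is still connected by 2-connectedness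
    but has one edge less. *)
Lemma betti_lt_setT E : two_connected Q -> E != [set: arrow Q]%SET ->
  betti E < betti [set: arrow Q]%SET.
Proof.
case/andP=> /eqP cT /forallP cD ET.
have [a aE] : exists a, a \notin E.
  apply/existsP; rewrite -negb_forall; apply: contra ET => /forallP h.
  by apply/eqP/setP=> a; rewrite h inE.
apply: (@le_lt_trans _ _ (betti ([set: arrow Q] :\ a)%SET)).
  by apply/betti_mono/fintype.subsetP=> b bE; rewrite !inE andbT; apply: contraNneq aE => <-.
rewrite /betti cT (eqP (cD a)) ltrD2l ltz_nat.
by rewrite [X in (_ < X)%N](finset.cardsD1 a) inE.
Qed.
End Graph_lemmas.

(** * Orbits and stabilizers *)

Section Truncated_polynomials.
Variables (F : finFieldType) (n : nat).
Local Notation O_ := {poly %/ ('X^(n.+1) : {poly F})}.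
Implicit Types p r : O_.

Lemma coef_trunc_ge p k : (n < k)%N -> p`_k = 0.
Proof.
move=> nk; apply: nth_default; apply: leq_trans nk.
by apply: leq_trans (size_npoly p) _; rewrite mk_monic_Xn size_polyXn.
Qed.

Lemma trunc_eqP p r : (forall k, (k <= n)%N -> p`_k = r`_k) -> p = r.
Proof.
move=> e; apply/npolyP => k; have [/e//|nk] := leqP k n.
by rewrite !coef_trunc_ge.
Qed.

Lemma coef_truncM p r k : (k <= n)%N ->
  (p * r)`_k = \sum_(i < k.+1) p`_i * r`_(k - i).
Proof.
move=> kn; rewrite -coefM poly_of_qpolyM [X in Pdiv.CommonRing.rmodp _ X]mk_monic_Xn.
rewrite -[Pdiv.CommonRing.rmodp _ _]/(Pdiv.Ring.rmodp _ _).
rewrite -Pdiv.IdomainMonic.modpE ?monicXn //.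
by rewrite [in RHS](divp_eq ((p : {poly F}) * r) 'X^(n.+1)) coefD coefMXn ltnS kn add0r.
Qed.

(** Units of the quotient are defined as the polynomials coprime to the modulus, here a power of
    ['X]. *)
Lemma trunc_unitE p : (p \is a GRing.unit) = (p`_0 != 0).
Proof.
rewrite -[LHS]/(coprimep (mk_monic ('X^(n.+1) : {poly F})) p) [X in coprimep X _]mk_monic_Xn.
rewrite coprimep_pexpl // coprimep_sym -[X in coprimep _ X]subr0 coprimep_XsubC.
by rewrite /root horner_coef0.
Qed.

(** In terms of valuations: a product vanishes iff val(p) + val(r) > n. *)
Lemma trunc_mul_eq0P p r : reflect
  (forall k j, (k + j <= n)%N -> r`_j != 0 -> p`_k = 0) (p * r == 0).
Proof.
apply: (iffP eqP) => [pr0|H]; last first.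
  apply: trunc_eqP => k kn; rewrite coef_truncM // coef0 big1 // => i _.
  have [->|rn] := eqVneq r`_(k - i) 0; first by rewrite mulr0.
  rewrite (H i (k - i)%N) ?mul0r // subnKC //; by rewrite -ltnS ltn_ord.
move=> k j kj rj; apply/eqP/negP=> /negP pk.
have ek : exists k, p`_k != 0 by exists k.
have ej : exists j, r`_j != 0 by exists j.
case: (ex_minnP ek) => k0 pk0 mk; case: (ex_minnP ej) => j0 rj0 mj.
have le : (k0 + j0 <= n)%N.
  by apply: leq_trans kj; apply: leq_add; [exact: mk|exact: mj].
have := coef_truncM p r le; rewrite pr0 coef0.
(* As [k0] and [j0] are the valuations, the coefficient [k0 + j0] of the product reduces to its term
   [i = k0]. *)
rewrite (bigD1 (inord k0)) //= big1 ?addr0 => [|i ik0].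
  rewrite inordK ?ltnS ?leq_addr // addKn => /esym/eqP.
  by rewrite mulf_eq0 (negPf pk0) (negPf rj0).
have {ik0} : (i != k0 :> nat).
  by apply: contra ik0 => /eqP e; apply/eqP/val_inj; rewrite /= inordK ?ltnS ?leq_addr.
rewrite neq_ltn => /orP[ik|ki].
  have [->|/mk] := eqVneq p`_i 0; first by rewrite mul0r.
  by rewrite leqNgt ik.
have [->|/mj] := eqVneq r`_(k0 + j0 - i) 0; first by rewrite mulr0.
by move=> h; have := ltn_ord i; lia.
Qed.

End Truncated_polynomials.

(** Within a class the inverse sizes add up to 1, and [D] is a union of classes. *)
Lemma sum_inv_card_class (K : numFieldType) (T : finType) (e : rel T) (D : {pred T}) :
  equivalence_rel e -> (forall x y, e x y -> (x \in D) = (y \in D)) ->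
  #|[set [set y | e x y] | x in D]%SET|%:R
  = \sum_(x in D) (#|[set y | e x y]%SET|%:R)^-1 :> K.
Proof.
move=> eqe De; pose cls x := [set y | e x y]%SET.
rewrite (partition_big_imset cls) /= -sum1_card natr_sum.
apply: eq_bigr => _ /imsetP[x xD ->].
have xx : e x x by case: (eqe x x x).
rewrite (eq_bigl [in cls x]) => [|y]; last first.
  rewrite inE; apply/andP/idP => [[_ /eqP/setP/(_ y)]|xy].
    by rewrite !inE => <-; case: (eqe y y y).
  split; first by rewrite -(De _ _ xy).
  apply/eqP/setP => z; rewrite !inE; case: (eqe x y z) => _ /(_ xy) //.
rewrite (eq_bigr (fun=> (#|cls x|%:R)^-1)) => [|y]; last first.
  rewrite inE => xy; congr (_%:R^-1); apply: eq_card => z; rewrite !inE.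
  by case: (eqe x y z) => _ /(_ xy).
rewrite sumr_const -(mulr_natr _^-1) mulVf // pnatr_eq0 -lt0n.
by apply/card_gt0P; exists x; rewrite inE.
Qed.

Section Orbits.
Variables (Q : quiver) (F : finFieldType) (n : nat).
Local Notation O_ := {poly %/ ('X^(n.+1) : {poly F})}.
Local Notation rep := {ffun arrow Q -> O_}.
Local Notation gauge := {ffun vertex Q -> O_}.
Implicit Types (x y : rep) (g : gauge).

Definition gauge_act g x : rep :=
  [ffun a => g (tgt a) * x a * (g (src a))^-1].

Definition gauges : {set gauge} :=
  [set g : gauge | [forall i, g i \is a GRing.unit]]%SET.

Definition stabilizer x : {set gauge} :=
  [set g in gauges | gauge_act g x == x]%SET.

Lemma gaugesP g : reflect (forall i, g i \is a GRing.unit) (g \in gauges).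
Proof. by rewrite inE; apply: forallP. Qed.

Lemma isomorphic_repP x y :
  reflect (exists2 g, g \in gauges & y = gauge_act g x) (isomorphic_rep x y).
Proof.
apply: (iffP existsP) => [[g /andP[gG /forallP gx]]|[g gG ->]]; exists g.
- by rewrite inE.
- by apply/ffunP=> a; rewrite ffunE (eqP (gx a)).
- by move: gG; rewrite inE => ->; apply/forallP=> a; rewrite ffunE.
Qed.

Lemma gauge_actM g h x : g \in gauges -> h \in gauges ->
  gauge_act g (gauge_act h x) = gauge_act [ffun i => g i * h i] x.
Proof.
move=> /gaugesP gU /gaugesP hU; apply/ffunP=> a; rewrite !ffunE invrM //.
by rewrite !mulrA.
Qed.

Lemma gauge_act1 x : gauge_act [ffun=> 1] x = x.
Proof. by apply/ffunP=> a; rewrite !ffunE invr1 mulr1 mul1r. Qed.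

Lemma gauges1 : ([ffun=> 1] : gauge) \in gauges.
Proof. by apply/gaugesP=> i; rewrite ffunE unitr1. Qed.

Lemma gaugesM g h : g \in gauges -> h \in gauges ->
  ([ffun i => g i * h i] : gauge) \in gauges.
Proof. by move=> /gaugesP gU /gaugesP hU; apply/gaugesP=> i; rewrite ffunE unitrMl. Qed.

Lemma gaugesV g : g \in gauges -> ([ffun i => (g i)^-1] : gauge) \in gauges.
Proof. by move=> /gaugesP gU; apply/gaugesP=> i; rewrite ffunE unitrV. Qed.

Lemma gauge_actK g x : g \in gauges ->
  gauge_act [ffun i => (g i)^-1] (gauge_act g x) = x.
Proof.
move=> gG; rewrite gauge_actM ?gaugesV // -[RHS]gauge_act1; congr gauge_act.
by apply/ffunP=> i; rewrite !ffunE mulVr //; apply/gaugesP.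
Qed.

Lemma isomorphic_rep_equiv : equivalence_rel (@isomorphic_rep Q F n.+1).
Proof.
have sym x y : isomorphic_rep x y -> isomorphic_rep y x.
  case/isomorphic_repP=> g gG ->; apply/isomorphic_repP.
  by exists [ffun i => (g i)^-1]; rewrite ?gaugesV ?gauge_actK.
have trans x y z : isomorphic_rep x y -> isomorphic_rep y z -> isomorphic_rep x z.
  case/isomorphic_repP=> g gG -> /isomorphic_repP[h hG ->].
  by apply/isomorphic_repP; exists [ffun i => h i * g i]; rewrite ?gaugesM ?gauge_actM.
move=> x y z; split.
  by apply/isomorphic_repP; exists [ffun=> 1]; rewrite ?gauges1 ?gauge_act1.
by move=> xy; apply/idP/idP; apply: trans => //; apply: sym.
Qed.

Lemma isomorphic_rep_abs_indecomposable x y : isomorphic_rep x y ->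
  abs_indecomposable x = abs_indecomposable y.
Proof.
case/isomorphic_repP=> g /gaugesP gU ->; rewrite /abs_indecomposable.
congr connected_graph; apply/setP=> a; rewrite !inE ffunE; congr negb.
apply/eqP/eqP => [->|]; first by rewrite mulr0 mul0r.
move=> /(congr1 ( *%R^~ (g (src a)))); rewrite mul0r mulrVK // => e.
by rewrite -[x a](mulKr (gU (tgt a))) e mulr0.
Qed.

Lemma card_orbit_stabilizer x :
  #|gauges| = (#|[set y | isomorphic_rep x y]%SET| * #|stabilizer x|)%N.
Proof.
rewrite -sum1_card (partition_big_imset (gauge_act^~ x)) /=.
have -> : (gauge_act^~ x @: gauges)%SET = [set y | isomorphic_rep x y]%SET.
  by apply/setP=> y; rewrite inE; apply/imsetP/isomorphic_repP.
rewrite -sum_nat_const; apply: eq_bigr => y; rewrite inE.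
case/isomorphic_repP=> g gG ->; rewrite sum1dep_card.
(* The gauges sending [x] to [gauge_act g x] form the coset of the stabilizer through [g]. *)
rewrite -(@card_imset _ _ (fun h : gauge => [ffun i => g i * h i] : gauge)
  (stabilizer x)); last first.
  move=> h k /ffunP e; apply/ffunP=> i; have := e i; rewrite !ffunE.
  by apply: mulrI; apply/gaugesP.
apply: eq_card => h; apply/idP/imsetP.
  rewrite !inE => /andP[hG /eqP hx].
  exists [ffun i => (g i)^-1 * h i]; last first.
    by apply/ffunP=> i; rewrite !ffunE mulVKr //; apply/gaugesP.
  have hG' : h \in gauges by rewrite inE.
  rewrite inE -[X in gauge_act X](_ : [ffun i => [ffun i => (g i)^-1] i * h i] = _).
    rewrite -gauge_actM ?gaugesV // hx gauge_actK // eqxx andbT.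
    rewrite (_ : [ffun i => _] = [ffun i => [ffun i => (g i)^-1] i * h i]).
      by rewrite gaugesM ?gaugesV.
    by apply/ffunP=> i; rewrite !ffunE.
  by apply/ffunP=> i; rewrite !ffunE.
case=> k /finset.setIdP[kG /eqP kx] ->.
by rewrite inE gaugesM //= -gauge_actM // kx.
Qed.

(** An orbit is counted by giving each of its points the inverse of the orbit size as weight. *)
Lemma kac_countE (K : numFieldType) : (kac_count Q F n.+1)%:R
  = \sum_(x : rep | abs_indecomposable x) #|stabilizer x|%:R / #|gauges|%:R :> K.
Proof.
rewrite /kac_count (sum_inv_card_class _ isomorphic_rep_equiv); last first.
  move=> x y; rewrite !inE; exact: isomorphic_rep_abs_indecomposable.
apply: eq_big => [x|x _]; first by rewrite inE.
rewrite (card_orbit_stabilizer x) natrM invfM mulrCA divff ?mulr1 //.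
by rewrite pnatr_eq0 -lt0n; apply/card_gt0P; exists [ffun=> 1]; rewrite inE gauges1 gauge_act1 /=.
Qed.

End Orbits.

(** * Coefficient layers and the order of stabilizers *)

Lemma card_familyE (I D : finType) (P : I -> {pred D}) :
  #|family P| = (\prod_i #|P i|)%N.
Proof.
rewrite card_family -(big_enum _ _ predT) /= /image_mem.
by elim: (enum _) => [|i s IHs] /=; rewrite ?big_nil // big_cons IHs.
Qed.

Section Layers.
Variables (F : finFieldType) (n : nat).
Local Notation O_ := {poly %/ ('X^(n.+1) : {poly F})}.

(** Transposing to coefficient vectors lets a sum over representations be taken one power of t at a
    time. *)
Definition layers (I : finType) (x : {ffun I -> O_}) :
    {ffun 'I_n.+1 -> {ffun I -> F}} := [ffun k : 'I_n.+1 => [ffun i => (x i)`_k]].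

Lemma layers_bij (I : finType) : bijective (@layers I).
Proof.
pose inv (t : {ffun 'I_n.+1 -> {ffun I -> F}}) : {ffun I -> O_} :=
  [ffun i => npolyp _ (\poly_(k < n.+1) t (inord k) i)].
have sz k : (k < (size (mk_monic ('X^(n.+1) : {poly F}))).-1)%N = (k < n.+1)%N.
  by rewrite mk_monic_Xn size_polyXn.
exists inv => [x|t].
  apply/ffunP=> i; rewrite ffunE; apply: trunc_eqP => k kn.
  by rewrite coef_npolyp coef_poly sz ltnS kn !ffunE inordK.
apply/ffunP=> k; apply/ffunP=> i; rewrite !ffunE coef_npolyp coef_poly.
by rewrite sz ltn_ord inord_val.
Qed.
End Layers.

Section Cumulated_support.
Variables (F : finFieldType) (A : finType).
Implicit Types S : {set A}.

Definition supp (c : {ffun A -> F}) : {set A} := [set a | c a != 0]%SET.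

(* For t = layers x and S = set0: the arrows a such that x_a has valuation at most m. *)
Definition cumsupp n S (t : {ffun 'I_n -> {ffun A -> F}}) (m : nat) : {set A} :=
  (S :|: [set a | [exists j : 'I_n, (j <= m)%N && (t j a != 0)]])%SET.

End Cumulated_support.

Section Stabilizers.
Variables (Q : quiver) (F : finFieldType) (n : nat).
Local Notation O_ := {poly %/ ('X^(n.+1) : {poly F})}.
Local Notation rep := {ffun arrow Q -> O_}.
Local Notation gauge := {ffun vertex Q -> O_}.
Implicit Types (x : rep) (g : gauge).

(** Fixing [x] means that g_t(a) - g_s(a) annihilates x_a for every arrow [a]; by valuations, the
    coefficients of t^k at both ends agree as soon as val(x_a) <= n - k. *)
Lemma stabilizerP x g :
  reflect ((forall i, (g i)`_0 != 0) /\
           forall k : 'I_n.+1, arrow_invariant (cumsupp finset.set0 (layers x) (n - k))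
                                        (layers g k))
          (g \in stabilizer x).
Proof.
have fixP (gU : forall i, g i \is a GRing.unit) a :
    reflect (forall k j, (k + j <= n)%N -> (x a)`_j != 0 ->
      (g (tgt a))`_k = (g (src a))`_k) (gauge_act g x a == x a).
  have -> : (gauge_act g x a == x a) = ((g (tgt a) - g (src a)) * x a == 0).
    rewrite ffunE mulrBl subr_eq0 [g (src a) * _]mulrC.
    apply/eqP/eqP => [/(congr1 ( *%R^~ (g (src a))))|->]; first by rewrite mulrVK.
    by rewrite mulrK.
  apply: (iffP (trunc_mul_eq0P _ _)) => H k j kj xj.
    by have := H k j kj xj; rewrite coefB => /eqP; rewrite subr_eq0 => /eqP.
  by rewrite coefB (H k j) ?subrr.
apply: (iffP finset.setIdP) => [[/gaugesP gU /eqP/ffunP gx]|[g0 gS]].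
  split=> [i|k]; first by rewrite -trunc_unitE.
  apply/forall_inP=> a; rewrite !inE /= => /existsP[j /andP[jk]]; rewrite !ffunE => xj.
  apply/eqP; have /eqP/fixP := gx a; apply=> //; last exact: xj.
  by have := ltn_ord k; lia.
have gU i : g i \is a GRing.unit by rewrite trunc_unitE.
split; first exact/gaugesP.
apply/eqP/ffunP=> a; apply/eqP/(fixP gU) => k j kj xj.
have kn : (k < n.+1)%N by lia.
have jn : (j < n.+1)%N by lia.
have /forall_inP/(_ a) := gS (Ordinal kn); rewrite !ffunE => /(_ _)/eqP; apply.
rewrite !inE /=; apply/existsP; exists (Ordinal jn); rewrite !ffunE xj andbT /=.
by lia.
Qed.

(** The layers of a stabilising gauge are chosen independently; the constant layer must avoid zero,
    whence the factor with base [#|F|.-1]. *)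
Lemma card_stabilizer x (S := cumsupp finset.set0 (layers x)) :
  #|stabilizer x| = (#|F|.-1 ^ components (S n)
                     * \prod_(k < n) #|F| ^ components (S k))%N.
Proof.
pose X (k : 'I_n.+1) : {pred F} := if k == ord0 then predC1 0 else predT.
pose P (k : 'I_n.+1) : {pred {ffun vertex Q -> F}} :=
  [pred h | arrow_invariant (S (n - k)%N) h && [forall i, h i \in X k]].
have cP k (e : F) : e \in X k -> #|P k| = (#|X k| ^ components (S (n - k)%N))%N.
  by move=> eX; rewrite -(card_arrow_invariant _ eX); apply: eq_card => h; rewrite [RHS]inE.
have -> : stabilizer x = (layers (I := vertex Q) @^-1: [set t in family P])%SET.
  apply/setP=> g; rewrite [RHS]inE [RHS]inE; apply/stabilizerP/familyP => [[g0 gS] k|gP].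
    rewrite inE gS /=; apply/forallP=> i; rewrite !ffunE /X.
    by case: eqP => // ->; rewrite inE.
  split=> [i|k]; last by have := gP k; rewrite inE => /andP[].
  have := gP ord0; rewrite inE => /andP[_ /forallP/(_ i)].
  by rewrite !ffunE /X eqxx inE.
rewrite on_card_preimset; last exact/onW_bij/layers_bij.
rewrite cardsE card_familyE big_ord_recl; congr (_ * _)%N.
  rewrite (cP ord0 1); last by rewrite /X eqxx inE oner_eq0.
  by rewrite /X eqxx subn0 cardC1.
(* Layer [k] of the gauge is governed by [S (n - k)], so the layers 1 to n are reversed. *)
rewrite (reindex_inj rev_ord_inj); apply: eq_bigr => k _.
have X1 (i : 'I_n) : X (lift ord0 i) = predT by rewrite /X eq_sym (negPf (neq_lift _ _)).
rewrite (cP (lift ord0 (rev_ord k)) 1); last by rewrite X1.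
have -> : (n - lift ord0 (rev_ord k) = k)%N.
  by rewrite /= /bump /=; have := ltn_ord k; lia.
by rewrite X1.
Qed.

(** All gauges fix the zero representation, whose cumulated supports are empty. *)
Lemma card_gauges : #|gauges Q F n| = ((#|F|.-1 * #|F| ^ n) ^ #|vertex Q|)%N.
Proof.
have -> : gauges Q F n = stabilizer [ffun=> 0].
  apply/setP=> g; apply/idP/finset.setIdP => [gG|[]//]; split=> //.
  by apply/eqP/ffunP=> a; rewrite !ffunE mulr0 mul0r.
have S0 k : cumsupp finset.set0 (layers [ffun=> 0 : O_]) k = finset.set0 :> {set arrow Q}.
  apply/setP=> a; rewrite !inE; apply/existsP => -[j /andP[_]].
  by rewrite !ffunE coef0 eqxx.
rewrite card_stabilizer S0 components0; under eq_bigr do rewrite S0 components0.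
by rewrite prod_nat_const card_ord expnMn -!expnM (mulnC n).
Qed.
End Stabilizers.

(** * Multichain sums *)

Section Layer_sums.
Variables (K : numFieldType) (F : finFieldType) (A : finType).
Implicit Types (S E : {set A}) (omega phi w : {set A} -> K).

(** The argument of [phi] is the final support: all indices of [t] are below [n], and for [n = 0] it
    is [S] itself. *)
Definition layer_sum omega phi n S : K :=
  \sum_(t : {ffun 'I_n -> {ffun A -> F}})
    phi (cumsupp S t n) * \prod_(m < n) omega (cumsupp S t m).

(** The sum over multichains S <= E_1 <= ... <= E_n of w(E_1) ... w(E_n) phi(E_n). *)
Fixpoint chain_sum w phi n S : K :=
  if n is n'.+1 then \sum_(E : {set A} | S \subset E) w E * chain_sum w phi n' E
  else phi S.

Lemma layer_sum0 omega phi S : layer_sum omega phi 0 S = phi S.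
Proof.
rewrite /layer_sum (big_pred1 [ffun i : 'I_0 => [ffun=> 0]]) => [|t]; last first.
  by apply/esym/eqP/ffunP => -[].
rewrite big_ord0 mulr1; congr phi; apply/setP=> a; rewrite !inE.
by case: (a \in S) => //=; apply/existsP=> -[[]].
Qed.

(** The first layer [c] is split off; for the remaining layers its support is absorbed into the
    starting set. *)
Lemma layer_sumS omega phi n S : layer_sum omega phi n.+1 S =
  \sum_(c : {ffun A -> F}) omega (S :|: supp c)%SET
                           * layer_sum omega phi n (S :|: supp c)%SET.
Proof.
pose C := {ffun A -> F}.
pose cons (p : C * {ffun 'I_n -> C}) : {ffun 'I_n.+1 -> C} :=
  [ffun i => oapp p.2 p.1 (unlift ord0 i)].
pose dec (t : {ffun 'I_n.+1 -> C}) := (t ord0, [ffun i => t (lift ord0 i)]).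
have consK : cancel cons dec.
  case=> c t; rewrite /dec ffunE unlift_none /=; congr pair; apply/ffunP=> i.
  by rewrite !ffunE liftK.
have decK : cancel dec cons.
  move=> t; apply/ffunP=> i; rewrite ffunE /=.
  by case: unliftP => [j ->|->] //=; rewrite ffunE.
have cumS c t m : cumsupp S (cons (c, t)) m.+1 = cumsupp (S :|: supp c)%SET t m.
  apply/setP=> a; rewrite !inE -orbA; congr orb; apply/existsP/orP.
    case=> j; rewrite ffunE /=; case: unliftP => [i ->|->] /=.
      by move=> h; right; apply/existsP; exists i.
    by left.
  case=> [ca|/existsP[i h]]; first by exists ord0; rewrite ffunE unlift_none.
  by exists (lift ord0 i); rewrite ffunE liftK.
have cum0 c t : cumsupp S (cons (c, t)) 0 = (S :|: supp c)%SET.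
  apply/setP=> a; rewrite !inE; congr orb; apply/existsP/idP.
    by case=> j /andP[]; rewrite leqn0 => /eqP j0; rewrite (_ : j = ord0) ?ffunE ?unlift_none //; apply: val_inj.
  by exists ord0; rewrite ffunE unlift_none.
rewrite /layer_sum (reindex cons); last by exists dec => t _; [exact: consK|exact: decK].
under [RHS]eq_bigr do rewrite big_distrr.
rewrite [RHS]pair_bigA /=; apply: eq_bigr => -[c t] _.
rewrite cumS big_ord_recl cum0 /= mulrCA; congr (_ * (_ * _)).
by apply: eq_bigr => i _; rewrite cumS.
Qed.

(** Coefficients are free on [S], nonzero on [E] outside [S], and zero outside [E]. *)
Lemma card_supp_setU S E : S \subset E ->
  #|[set c : {ffun A -> F} | (S :|: supp c == E)%SET]%SET|
  = (#|F| ^ #|S| * #|F|.-1 ^ #|E :\: S|%SET)%N.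
Proof.
move=> sSE.
pose X a : {pred F} := if a \in S then predT else if a \in E then predC1 0 else pred1 0.
transitivity #|family X|.
  apply: eq_card => c; rewrite inE; apply/eqP/familyP => [e a|cX].
    rewrite /X -e !inE; case: (a \in S) => //=.
    by case: ifP => //; rewrite !inE => /negbT; rewrite negbK.
  apply/setP=> a; rewrite !inE; have := cX a; rewrite /X.
  have /implyP := fintype.subsetP sSE a.
  by case: (a \in S); case: (a \in E) => //=; rewrite !inE // => _ ->.
rewrite card_familyE (bigID [in S]) /=; congr (_ * _)%N.
  by rewrite -prod_nat_const; apply: eq_bigr => a aS; rewrite /X aS.
rewrite (bigID [in E]) /= [X in (_ * X)%N]big1 => [|a /andP[/negPf aS /negPf aE]]; last first.
  by rewrite /X aS aE card1.
rewrite muln1 -prod_nat_const; apply: eq_big => [a|a /andP[/negPf aS aE]].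
  by rewrite inE.
by rewrite /X aS aE cardC1.
Qed.

(** The number of layers leading from [S] to [E] is q^|E| (1 - q^-1)^(|E| - |S|), so the factors (1
    - q^-1)^|S| telescope along the multichain. *)
Lemma layer_sum_chain omega phi n S q : q = #|F|%:R ->
  (1 - q^-1) ^+ #|S| * layer_sum omega phi n S
  = chain_sum (fun E => q ^+ #|E| * omega E)
      (fun E => (1 - q^-1) ^+ #|E| * phi E) n S.
Proof.
move=> qE; have q0 : q != 0 by rewrite qE pnatr_eq0 -lt0n; apply/card_gt0P; exists 0.
elim: n S => [|n IHn] S; first by rewrite layer_sum0.
rewrite layer_sumS /=.
rewrite (partition_big (fun c => (S :|: supp c)%SET) (fun E => S \subset E)) /=; last first.
  by move=> c _; apply: finset.subsetUl.
rewrite big_distrr; apply: eq_bigr => E sSE /=.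
rewrite (eq_bigr (fun=> omega E * layer_sum omega phi n E)) => [|c /eqP-> //].
rewrite (eq_bigl [in [set c : {ffun A -> F} | (S :|: supp c == E)%SET]%SET]) => [|c];
  last by rewrite inE.
rewrite sumr_const -IHn.
rewrite card_supp_setU // -mulr_natr natrM !natrX.
have -> : (#|F|.-1)%:R = q * (1 - q^-1).
  by rewrite mulrBr divff // mulr1 qE -subn1 natrB //; apply/card_gt0P; exists 0.
rewrite exprMn -(finset.cardsID S E) (finset.setIidPr sSE) !exprD -qE.
ring.
Qed.

End Layer_sums.

Lemma cumsupp_layers (F : finFieldType) n (A : finType)
    (x : {ffun A -> {poly %/ ('X^(n.+1) : {poly F})}}) m : (n <= m)%N ->
  cumsupp finset.set0 (layers x) m = [set a | x a != 0]%SET.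
Proof.
move=> nm; apply/setP=> a; rewrite !inE /=; apply/existsP/idP => [[j]|].
  by rewrite !ffunE => /andP[_]; apply: contraNneq => ->; rewrite coef0.
move=> xa; apply/existsP; apply: contraNT xa; rewrite negb_exists => /forallP H.
apply/eqP/trunc_eqP => k kn; have := H (Ordinal (kn : (k < n.+1)%N)).
by rewrite !ffunE /= coef0 (leq_trans kn nm) /= negbK => /eqP.
Qed.

(** * The normalised count as a multichain sum, and limits of such sums *)

Section Normalized_count.
Variables (R : realType) (Q : quiver) (F : finFieldType).
Let q : R := #|F|%:R.
Let b : int := betti [set: arrow Q]%SET.

Lemma normalized_count_chain n : connected_graph [set: arrow Q]%SET ->
  normalized_count R Q F n.+1 =
  chain_sum (fun E : {set arrow Q} => q ^ (- (b - betti E)))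
    (fun E => (connected_graph E)%:R * (1 - q^-1) ^ betti E) n.+1 finset.set0.
Proof.
move=> cT; have q1 : 1 < q by rewrite ltr1n (cardD1 0) (cardD1 1) !inE oner_eq0.
have q0 : q != 0 by rewrite gt_eqF // (lt_trans _ q1).
have p0 : 1 - q^-1 != 0 by rewrite subr_eq0 eq_sym invr_eq1 gt_eqF.
(* With these weights, q^|E| omega(E) = q^-(b(Q) - b(Q|_E)), and (1 - q^-1)^|E| phi(E) is the
   required final weight because b(Q|_E) = 1 - |Q_0| + |E| for connected [E]. *)
pose omega (E : {set arrow Q}) := q ^ ((components E)%:Z - #|vertex Q|%:Z - b).
pose phi (E : {set arrow Q}) := (connected_graph E)%:R * (1 - q^-1) ^ (1 - #|vertex Q|%:Z).
have bT : b = 1 - #|vertex Q|%:Z + #|arrow Q|%:Z by rewrite /b /betti (eqP cT) cardsT.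
transitivity (layer_sum F omega phi n.+1 finset.set0); last first.
  have := layer_sum_chain omega phi n.+1 finset.set0 (erefl q).
  rewrite finset.cards0 expr0 mul1r => ->; congr chain_sum; apply/funext => E.
    rewrite /omega exprnP -expfzDr //; congr (q ^ _).
    by rewrite /betti -/b; lia.
  rewrite /phi mulrCA; have [/eqP cE|_] := boolP (connected_graph E); last by rewrite !mul0r.
  by rewrite exprnP -expfzDr // /betti cE; congr (_ * (_ ^ _)); lia.
rewrite /normalized_count kac_countE -/q.
have -> : q ^ (- (n.+1%:Z * (1 - #|vertex Q|%:Z + #|arrow Q|%:Z))) = (q ^ (- b)) ^+ n.+1.
  by rewrite exprnP exprz_exp bT mulNr mulrC.
rewrite /layer_sum mulr_sumr (reindex (@layers F n (arrow Q))) /=; last exact/onW_bij/layers_bij.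
have conn_last (x : {ffun arrow Q -> {poly %/ ('X^(n.+1) : {poly F})}}) m : (n <= m)%N ->
    abs_indecomposable x = connected_graph (cumsupp finset.set0 (layers x) m).
  by move=> nm; rewrite cumsupp_layers.
rewrite [RHS](bigID (fun x => abs_indecomposable x)) /=.
rewrite [X in _ = _ + X]big1 ?addr0 => [|x nx]; last first.
  by rewrite /phi -(conn_last _ n.+1) // (negPf nx) !mul0r.
apply: eq_bigr => x cx; rewrite card_stabilizer card_gauges.
rewrite /phi -(conn_last _ n.+1) // cx mul1r big_ord_recr /=.
(* The last cumulated support is connected, so the constant layer of the stabilizer contributes a
   single factor q - 1. *)
move: (cx); rewrite (conn_last _ n) // => /eqP cn.
rewrite /omega cn expn1.
rewrite (eq_bigr (fun k : 'I_n => q ^+ components (cumsupp finset.set0 (layers x) k)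
  * (q ^- #|vertex Q| * q ^ (- b)))) => [|k _]; last first.
  by rewrite -addrA !expfzDr // -(invr_expz q #|vertex Q|) -!exprnP.
rewrite big_split prodr_const card_ord /=.
rewrite -addrA !expfzDr // -!(invr_expz _ #|vertex Q|) -!exprnP !expr1.
rewrite !natrM !natrX natrM natrX.
rewrite natr_prod; under eq_bigr do rewrite natrX.
have -> : (#|F|.-1)%:R = q * (1 - q^-1).
  by rewrite mulrBr divff // mulr1 -subn1 natrB //; apply/card_gt0P; exists 0.
rewrite -/q !exprMn exprVn -[(q ^+ n) ^+ _]exprM mulnC exprM exprS.
have : (1 - q^-1) ^+ #|vertex Q| != 0 by rewrite expf_neq0.
have : q ^+ #|vertex Q| != 0 by rewrite expf_neq0.
move: (\prod_(i < n) _) (q ^+ #|vertex Q|) => P u.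
move: ((1 - q^-1) ^+ #|vertex Q|) (q ^ (- b)) => pV y u0 pV0.
by field; rewrite u0 pV0 expf_neq0 //= q0.
Qed.
End Normalized_count.

(** The difference from the fixed point l / (1 - w) obeys the same recurrence with forcing c(n) - l,
    which tends to 0, while the ratio [w] is below 1. *)
Lemma affine_recurrence_cvg (R : realType) (w l : R) (c x : nat -> R) :
  0 <= w < 1 -> (forall n, x n.+1 = w * x n + c n) ->
  (c @ \oo --> l)%classic -> (x @ \oo --> l / (1 - w))%classic.
Proof.
move=> /andP[w0 w1] xE cl; have w1' : 0 < 1 - w by rewrite subr_gt0.
have wn0 : 1 - w != 0 by rewrite gt_eqF.
pose y n := x n - l / (1 - w).
have yE n : y n.+1 = w * y n + (c n - l) by rewrite /y xE; field.
apply/cvgrPdist_le => e e0.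
(* Forcing below this bound accumulates to at most [e / 2], by the geometric series of ratio [w]. *)
have e2 : 0 < e / 2 * (1 - w) by rewrite mulr_gt0 // divr_gt0.
have [N _ cN] := (cvgrPdist_le _ _).1 cl _ e2.
have yN k : `|y (N + k)%N| <= w ^+ k * `|y N| + e / 2.
  elim: k => [|k IHk]; first by rewrite addn0 expr0 mul1r lerDl divr_ge0 // ltW.
  rewrite addnS yE; apply: (le_trans (ler_normD _ _)).
  rewrite normrM (ger0_norm w0) exprS.
  have := cN (N + k)%N (leq_addr _ _); rewrite distrC => ck.
  have : w * `|y (N + k)%N| <= w * (w ^+ k * `|y N| + e / 2) by rewrite ler_wpM2l.
  lra.
have wcvg : ((fun k => w ^+ k * `|y N|) @ \oo --> (0 : R))%classic.
  rewrite -[0](mul0r `|y N|); apply: cvgM; last exact: cvg_cst.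
  by apply: cvg_expr; rewrite ger0_norm.
have [M _ wM] := (cvgrPdist_le _ _).1 wcvg _ (divr_gt0 e0 (@ltr0Sn R 1)).
exists (N + M)%N => // n /= NMn.
have NMn' : (M <= n - N)%N by lia.
have -> : n = (N + (n - N))%N by lia.
rewrite distrC; apply: (le_trans (yN _)).
have := wM _ NMn'; rewrite sub0r normrN ger0_norm ?mulr_ge0 ?exprn_ge0 // => h.
rewrite [leRHS](splitr e) lerD2r //.
Qed.

Section Chain_sum_limit.
Variables (R : realType) (A : finType).
Implicit Types (S E : {set A}) (w z phi H : {set A} -> R).

(** The recursion, by the least set [E], for the sum of the products of [z] over strict chains of
    sets strictly between [S] and the full set; the empty chain gives 1. *)
Definition sums_proper_chains z H := forall S,
  H S = 1 + \sum_(E : {set A} | (S \proper E) && (E != [set: A]%SET)) z E * H E.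

Lemma chain_sum_setT w phi n : w [set: A]%SET = 1 ->
  chain_sum w phi n [set: A]%SET = phi [set: A]%SET.
Proof.
move=> wT; elim: n => //= n IHn.
by rewrite (big_pred1 [set: A]%SET) ?wT ?IHn ?mul1r // => E; rewrite finset.subTset.
Qed.

(** Induction on the complement of [S]. Splitting off the stationary step [E = S] gives an affine
    recurrence of ratio w(S), whose forcing converges by induction. The full set, where a multichain
    stays with weight 1, yields the summand 1 of H(S). *)
Lemma chain_sum_cvg w phi H S :
  (forall E, E != [set: A]%SET -> 0 <= w E < 1) -> w [set: A]%SET = 1 ->
  sums_proper_chains (fun E => w E / (1 - w E)) H -> S != [set: A]%SET ->
  ((fun n => chain_sum w phi n S) @ \oo
     --> phi [set: A]%SET * H S / (1 - w S))%classic.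
Proof.
move=> w01 wT HE; have [m] := ubnP #|~: S|%SET; elim: m => // m IHm in S *.
rewrite ltnS => Sm ST.
apply: (@affine_recurrence_cvg _ _ _
  (fun n => \sum_(E : {set A} | S \proper E) w E * chain_sum w phi n E)).
- exact: w01.
- move=> n /=; rewrite (bigD1 S) //=; congr (_ + _); apply: eq_bigl => E.
  by rewrite finset.properEneq eq_sym andbC.
have pST : S \proper [set: A]%SET by rewrite finset.properT.
rewrite HE mulrDr mulr1 mulr_sumr.
under eq_cvg do rewrite (bigD1 [set: A]%SET) //= wT mul1r chain_sum_setT //.
apply: cvgD; first exact: cvg_cst.
apply: (@cvg_big R _ +%R 0 _ (@pseudometric_normed_Zmodule.add_continuous _ R)) => E /andP[SE ET].
rewrite (_ : _ * _ = w E * (phi [set: A]%SET * H E / (1 - w E))); last by ring.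
apply: cvgM; first exact: cvg_cst.
apply: IHm => //; apply: leq_trans Sm; apply: proper_card.
by rewrite finset.properC.
Qed.
End Chain_sum_limit.

(** * The Hilbert series *)

Section Stanley_Reisner_dimension.
Variables (T : finType) (Delta : {set {set T}}).
Implicit Types (m : multinom #|T|) (p : mpoly #|T| rat) (G : {set T}).

Definition mono_supp m : {set T} := [set v | m (enum_rank v) != 0%N]%SET.

Lemma mcoeff_mul_SR_var p m v : m (enum_rank v) = 0%N ->
  mcoeff m (p * SR_var v) = 0.
Proof.
move=> mv; rewrite [p]mpolyE mulr_suml raddf_sum big1 //= => m' _.
rewrite -scalerAl -mpolyXD mcoeffZ mcoeffX; case: eqP => [e|]; last by rewrite mulr0.
by move: mv; rewrite -e mnmDE mnm1E eqxx addn1.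
Qed.

Lemma mono_in_SR_ideal m : mono_supp m \notin Delta ->
  SR_ideal Delta (mpolyX rat m).
Proof.
(* The cofactor of the squarefree monomial on the support of [m], which generates because that
   support is a nonface. *)
move=> nD; pose c := \prod_(v in mono_supp m) SR_var v ^+ (m (enum_rank v)).-1.
exists (fun G => if G == mono_supp m then c else 0).
rewrite (bigD1 (mono_supp m)) //= eqxx [X in _ + X]big1 => [|G /andP[_ /negPf->]]; last by rewrite mul0r.
rewrite addr0 -big_split mpolyXE_id (reindex _ (onW_bij _ (@enum_rank_bij T))) /=.
rewrite (bigID [in mono_supp m]) /= [X in _ * X]big1 ?mulr1 => [|v]; last first.
  by rewrite inE negbK => /eqP->.
by apply: eq_bigr => v; rewrite inE -lt0n -exprSr => /prednK->.
Qed.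

Hypothesis Delta_down : forall G G', G \subset G' -> G' \in Delta -> G \in Delta.

(** A nonface is not contained in a face, so each generator involves a variable outside the support
    of [m]. *)
Lemma mcoeff_SR_ideal p m : SR_ideal Delta p -> mono_supp m \in Delta -> mcoeff m p = 0.
Proof.
move=> [c ->] mD; rewrite raddf_sum big1 //= => G nG.
have [v vG vm] : exists2 v, v \in G & v \notin mono_supp m.
  by apply/subsetPn; apply: contra nG => /Delta_down; apply.
rewrite (bigD1 v) //= mulrCA mulrC mcoeff_mul_SR_var //.
by move: vm; rewrite inE negbK => /eqP.
Qed.

(** The graded piece is spanned by the class of the monomial, which is nonzero exactly over faces.
    As [SR_dim] is obtained by choice, every other dimension has to be excluded too. *)
Lemma SR_dimE m : SR_dim Delta m = (mono_supp m \in Delta).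
Proof.
have id0 : SR_ideal Delta 0.
  by exists (fun=> 0); rewrite big1 // => G _; rewrite mul0r.
rewrite /SR_dim; case: (boolP (mono_supp m \in Delta)) => mD; last first.
  have deg_id p : degree_part m p -> SR_ideal Delta p.
    case=> a ->; have [c ->] := mono_in_SR_ideal mD.
    exists (fun G => a *: c G); rewrite scaler_sumr.
    by apply: eq_bigr => G _; rewrite scalerAl.
  apply: xget_unique.
    exists (fun i : 'I_0 => 0); split=> [[]//|p /deg_id pI].
    exists [ffun i => 0]; split; first by rewrite big_ord0 subr0.
    by move=> c _; apply/ffunP => -[].
  move=> [//|d] [e [eW]] /(_ 0) []; first by exists 0; rewrite scale0r.
  move=> c [_ cU].
  (* All combinations lie in the ideal, so the constant vectors 0 and 1 both represent 0, against
     uniqueness. *)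
  have ad (a : {ffun 'I_d.+1 -> rat}) : SR_ideal Delta (0 - \sum_i a i *: e i).
    apply: deg_id; exists (- \sum_i a i * xget 0 [set b | e i = b *: mpolyX rat m]%classic).
    rewrite sub0r scaleNr scaler_suml; congr (- _); apply: eq_bigr => i _.
    rewrite -scalerA; congr (_ *: _); case: xgetP => [b _ -> //|h].
    by have [b eb] := eW i; case: (h b).
  have := cU [ffun=> 1] (ad _); rewrite (cU [ffun=> 0] (ad _)).
  by move/ffunP/(_ ord0)/eqP; rewrite !ffunE eq_sym oner_eq0.
have degI (a : rat) : SR_ideal Delta (a *: mpolyX rat m) -> a = 0.
  move=> /mcoeff_SR_ideal/(_ mD); rewrite mcoeffZ mcoeffX eqxx mulr1 //.
apply: xget_unique.
  exists (fun=> mpolyX rat m); split=> [_|_ [a ->]]; first by exists 1; rewrite scale1r.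
  exists [ffun=> a]; split; first by rewrite big_ord1 ffunE subrr.
  move=> c; rewrite big_ord1 -scalerBl => /degI/eqP; rewrite subr_eq0 => /eqP ->.
  by apply/ffunP=> i; rewrite ffunE; rewrite (ord1 i).
move=> d [e [eW eU]].
have [x eE] : exists x : 'I_d -> rat, forall i, e i = x i *: mpolyX rat m.
  exists (fun i => xget 0 [set b | e i = b *: mpolyX rat m]%classic) => i.
  case: xgetP => [b _ -> //|h]; by have [b eb] := eW i; case: (h b).
have sumE (c : {ffun 'I_d -> rat}) :
    \sum_i c i *: e i = (\sum_i c i * x i) *: mpolyX rat m.
  by rewrite scaler_suml; apply: eq_bigr => i _; rewrite eE scalerA.
have inj (c c' : {ffun 'I_d -> rat}) : \sum_i c i * x i = \sum_i c' i * x i -> c = c'.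
  move=> cc'; have [|c0 [_ c0U]] := eU (\sum_i c i *: e i).
    by rewrite sumE; exists (\sum_i c i * x i).
  by rewrite -(c0U c) ?(c0U c') //= !sumE cc' subrr.
case: d => [|[//|d]] in e eW eU x eE sumE inj *.
  have [|c [cI _]] := eU (mpolyX rat m); first by exists 1; rewrite scale1r.
  have := @degI 1; rewrite scale1r; move: cI; rewrite big_ord0 subr0 => h /(_ h).
  by move/eqP; rewrite oner_eq0.
have sumD (i : 'I_d.+2) a : \sum_j [ffun j => (j == i)%:R * a] j * x j = a * x i.
  rewrite (bigD1 i) //= ffunE eqxx mul1r big1 ?addr0 // => j /negPf ji.
  by rewrite ffunE ji !mul0r.
have x0 i : x i != 0.
  apply/eqP=> xi; have := inj [ffun j => (j == i)%:R * 1] [ffun j => (j == i)%:R * 0].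
  rewrite !sumD xi !mulr0 => /(_ erefl)/ffunP/(_ i)/eqP.
  by rewrite !ffunE eqxx mulr1 mulr0 oner_eq0.
(* For dimension at least 2, the relation x_1 e_0 = x_0 e_1 contradicts uniqueness of
   coefficients. *)
pose i1 : 'I_d.+2 := lift ord0 ord0.
have := inj [ffun i => (i == ord0)%:R * x i1] [ffun i => (i == i1)%:R * x ord0].
rewrite !sumD mulrC => /(_ erefl)/ffunP/(_ ord0)/eqP; rewrite !ffunE eqxx mul1r mul0r.
by rewrite (negPf (x0 _)).
Qed.
End Stanley_Reisner_dimension.

Section Hilbert_series.
Variables (R : realType) (T : finType) (Delta : {set {set T}}) (u : T -> R).
Hypothesis u01 : forall v, 0 <= u v < 1.
Hypothesis Delta_down : forall G G' : {set T}, G \subset G' -> G' \in Delta -> G \in Delta.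

Let term (m : multinom #|T|) : R :=
  (SR_dim Delta m)%:R * \prod_(v : T) u v ^+ m (enum_rank v).

(** The monomials with all exponents below [k]; these finite families exhaust the monomials as [k]
    grows. *)
Let box k (t : {ffun T -> 'I_k}) : multinom #|T| :=
  Multinom [tuple (t (enum_val i) : nat) | i < #|T|].

(** Exponent vectors are grouped by support [G]; for fixed [G] the sum factors over the vertices,
    with exponents from 1 to [k]. *)
Let box_sum k : \sum_(t : {ffun T -> 'I_k.+1}) term (box t)
  = \sum_(G in Delta) \prod_(v in G) \sum_(j < k) u v ^+ j.+1.
Proof.
have boxE (t : {ffun T -> 'I_k.+1}) v : box t (enum_rank v) = t v.
  by rewrite mnmE enum_rankK.
rewrite (partition_big (fun t : {ffun T -> 'I_k.+1} => [set v | t v != ord0]%SET) predT) //=.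
rewrite [RHS]big_mkcond; apply: eq_bigr => G _.
pose q v : pred 'I_k.+1 := fun j => (v \in G) == (j != ord0).
transitivity ((G \in Delta)%:R * \prod_v \sum_(j | q v j) u v ^+ j).
  rewrite bigA_distr_big_dep mulr_sumr; apply: eq_big => [t|t /eqP tG].
    apply/eqP/familyP => [e v|H]; first by rewrite unfold_in /q -e inE.
    by apply/setP=> v; rewrite inE; have := H v; rewrite unfold_in => /eqP.
  rewrite /term SR_dimE // (_ : mono_supp _ = G).
    by congr (_ * _); apply: eq_bigr => v _; rewrite boxE.
  by rewrite -tG; apply/setP=> v; rewrite !inE boxE.
case: ifP => _; last by rewrite mul0r.
rewrite mul1r [RHS]big_mkcond; apply: eq_bigr => v _; rewrite /q; case: (v \in G).
  rewrite big_mkcond big_ord_recl /= add0r.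
  by apply: eq_bigr => j _.
rewrite (big_pred1 ord0) => [//|j].
by rewrite -[RHS]/(j == ord0); case: (j == ord0).
Qed.

Let geo v k : \sum_(j < k) u v ^+ j.+1 = u v / (1 - u v) * (1 - u v ^+ k).
Proof.
have /andP[_ u1] := u01 v.
have n0 : 1 - u v != 0 by rewrite subr_eq0 gt_eqF.
under eq_bigr do rewrite exprS; rewrite -mulr_sumr.
rewrite -[1 - u v ^+ k]opprB subrX1; field.
by [].
Qed.

Let term_ge0 m : 0 <= term m.
Proof.
rewrite mulr_ge0 // prodr_ge0 // => v _; apply: exprn_ge0.
by have /andP[] := u01 v.
Qed.

Let z_ge0 v : 0 <= u v / (1 - u v).
Proof.
have /andP[u0 u1] := u01 v.
by rewrite divr_ge0 // subr_ge0 ltW.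
Qed.

(** A squeeze: every finite family of monomials lies in a box, whose sum is at most the right-hand
    side, and the box sums converge to it. *)
Lemma HilbE : Hilb Delta u = \sum_(G in Delta) \prod_(v in G) (u v / (1 - u v)).
Proof.
rewrite /Hilb; set l := RHS.
suff -> : (\esum_(m in [set: multinom #|T|]) (term m)%:E = l%:E)%E by [].
have boxE k : (\esum_(m in [set` codom (@box k.+1)]) (term m)%:E
    = (\sum_(G in Delta) \prod_(v in G) \sum_(j < k) u v ^+ j.+1)%:E)%E.
  rewrite -box_sum esum_fset; last 2 first.
  - exact: finite_seq.
  - by move=> m _; rewrite lee_fin.
  rewrite -fsbig_seq ?codomE ?big_map ?sumEFin ?big_enum //.
  rewrite map_inj_uniq ?enum_uniq // => t t' /(congr1 (fun m : multinom _ => m : _ -> _)) e.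
  apply/ffunP=> v; apply/val_inj; have := congr1 (@^~ (enum_rank v)) e.
  by rewrite /= !mnmE enum_rankK.
apply/eqP; rewrite eq_le; apply/andP; split.
  apply: ge_ereal_sup => _ [A [/finite_seqP[s ->] _] <-].
  rewrite -esum_fset; [|exact: finite_seq|by move=> m _; rewrite lee_fin].
  (* The total degree bounds each exponent. *)
  pose k := (\max_(m <- s) mdeg m)%N.
  apply: (@le_trans _ _ (\esum_(m in [set` codom (@box k.+1)]) (term m)%:E)%E).
    apply: ereal_sup_le; apply: image_subset => B [finB BA]; split=> // m /BA /= ms.
    apply/fintype.codomP; exists [ffun v => inord (m (enum_rank v))].
    apply/mnmP=> i; rewrite mnmE ffunE inordK ?enum_valK // ltnS.
    apply: leq_trans (leq_bigmax_seq m ms isT).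
    by rewrite mdegE (bigD1 i) //= leq_addr.
  rewrite boxE lee_fin; apply: ler_sum => G _; apply: ler_prod => v _.
  have /andP[u0 u1] := u01 v.
  rewrite sumr_ge0 => [/=|j _]; last exact: exprn_ge0.
  by rewrite geo ler_piMr // lerBlDr lerDl exprn_ge0.
have lim : ((fun k => \sum_(G in Delta) \prod_(v in G) \sum_(j < k) u v ^+ j.+1) @ \oo --> l)%classic.
  apply: (@cvg_big R _ +%R 0 _ (@pseudometric_normed_Zmodule.add_continuous _ R)) => G _.
  apply: (@cvg_big R _ *%R 1 _ (@mul_continuous R)) => v _.
  under eq_cvg do rewrite geo.
  suff : ((u v / (1 - u v) * (1 - u v ^+ k)) @[k --> \oo] --> u v / (1 - u v) * (1 - 0))%classic.
    by rewrite subr0 mulr1.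
  apply: cvgM; first exact: cvg_cst.
  apply: cvgB; first exact: cvg_cst.
  by apply: cvg_expr; have /andP[u0 u1] := u01 v; rewrite ger0_norm.
have limE : (((fun k => \sum_(G in Delta) \prod_(v in G) \sum_(j < k) u v ^+ j.+1) k)%:E @[k --> \oo]
   --> l%:E)%classic by apply: cvg_EFin => //; exact: nearW.
rewrite -(cvg_lim _ limE) //; apply: lime_le; first by apply/cvg_ex; exists l%:E.
apply: nearW => k; rewrite -boxE.
by apply: ereal_sup_le; apply: image_subset => B [finB _]; split.
Qed.
End Hilbert_series.

(** * Order complexes and chains of subsets *)

Lemma order_complexP (T : finType) (le : rel T) (G : {set T}) :
  reflect {in G &, forall x y, le x y || le y x} (G \in order_complex le).
Proof.
rewrite inE; apply: (iffP forall_inP) => [H x y xG yG|H x xG].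
  by have /forall_inP := H x xG; apply.
by apply/forall_inP => y yG; apply: H.
Qed.

Lemma order_complex_down (T : finType) (le : rel T) (G G' : {set T}) :
  G \subset G' -> G' \in order_complex le -> G \in order_complex le.
Proof.
move=> /fintype.subsetP sG /order_complexP H.
by apply/order_complexP => x y /sG xG /sG yG; apply: H.
Qed.

Section Subset_complex.
Variables (R : realType) (A : finType) (z : {set A} -> R).
Local Notation T := (proper_nonempty A).

Definition chains_above (S : {set A}) : R :=
  \sum_(G in subset_complex A | [forall v in G, S \proper val v])
    \prod_(v in G) z (val v).

Lemma chains_above0 :
  chains_above finset.set0 = \sum_(G in subset_complex A) \prod_(v in G) z (val v).
Proof.
apply: eq_bigl => G; apply/andb_idr => _; apply/forall_inP => v _.
by rewrite finset.proper0; case/andP: (valP v).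
Qed.

Let is_min (v : T) (G : {set T}) := (v \in G) && [forall w in G, val v \subset val w].

Let is_min_uniq v w G : is_min v G -> is_min w G -> v = w.
Proof.
case/andP=> vG /forall_inP vm /andP[wG /forall_inP wm].
by apply/val_inj/eqP; rewrite finset.eqEsubset vm ?wm.
Qed.

Let is_min_ex G : G \in subset_complex A -> G != finset.set0 -> exists v, is_min v G.
Proof.
move=> /order_complexP GD /finset.set0Pn[v0 v0G].
case: (arg_minnP (fun v : T => #|val v|) v0G) => v vG vm.
exists v; rewrite /is_min (vG : v \in G); apply/forall_inP => w wG.
case/orP: (GD v w vG wG) => // wv.
by have/eqP<- : val w == val v by rewrite eqEcard wv vm.
Qed.

(** Deleting the least element [v] of a chain leaves an arbitrary chain strictly above [v]. *)
Let sum_min (S : {set A}) (v : T) : S \proper val v ->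
  \sum_(G in subset_complex A | [forall v in G, S \proper val v] && is_min v G)
    \prod_(v in G) z (val v) = z (val v) * chains_above (val v).
Proof.
move=> Sv; rewrite /chains_above mulr_sumr.
rewrite (reindex_onto (fun G => v |: G)%SET (fun G => G :\ v)%SET) /=; last first.
  by move=> G /and3P[_ _ /andP[vG _]]; rewrite finset.setD1K.
apply: eq_big => [G|G /andP[_ /eqP e]].
  have -> : ((v |: G) :\ v == G)%SET = (v \notin G).
    apply/eqP/idP => [<-|]; first by rewrite !inE eqxx.
    exact: finset.setU1K.
  apply/idP/idP.
    case/andP=> /and3P[/order_complexP GD _ /andP[_ /forall_inP Gm]] vG.
    apply/andP; split.
      by apply/order_complexP => x y xG yG; apply: GD; rewrite !inE ?xG ?yG orbT.
    apply/forall_inP => w wG; rewrite finset.properEneq Gm ?inE ?wG ?orbT // andbT.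
    by apply: contraNneq vG => /val_inj ->.
  case/andP=> /order_complexP GD /forall_inP Gv; apply/andP; split; last first.
    by apply/negP=> /Gv; rewrite properE subxx.
  apply/and3P; split.
  - apply/order_complexP => x y; rewrite !inE.
    case/orP=> [/eqP->|xG] /orP[/eqP->|yG].
    + by rewrite subxx.
    + by rewrite proper_sub ?Gv.
    + by rewrite (proper_sub (Gv x xG)) orbT.
    + exact: GD.
  - apply/forall_inP => w; rewrite !inE => /orP[/eqP->//|/Gv].
    by apply: proper_trans.
  - rewrite /is_min !inE eqxx; apply/forall_inP => w; rewrite !inE.
    by case/orP=> [/eqP->//|/Gv/proper_sub].
rewrite finset.big_setU1 //=.
by rewrite -e !inE eqxx.
Qed.

(** The empty chain gives 1; the other chains are sorted by their least element. *)
Lemma chains_aboveE : sums_proper_chains z chains_above.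
Proof.
move=> S; rewrite {1}/chains_above (bigD1 finset.set0) /=; last first.
  apply/andP; split; last by apply/forall_inP => v; rewrite inE.
  by apply/order_complexP => x y; rewrite inE.
rewrite big1 => [|v]; last by rewrite inE.
congr (_ + _).
transitivity (\sum_(v : T | S \proper val v) z (val v) * chains_above (val v)); last first.
  rewrite [RHS](reindex_omap (val : T -> {set A}) insub) /=.
    apply: eq_bigl => v; rewrite valK eqxx andbT; have /andP[_ ->] := valP v.
    by rewrite andbT.
  (* A set strictly above [S] is nonempty, hence a vertex of the complex once it is not the full
     set. *)
  move=> E /andP[SE ET]; rewrite insubT ?ET ?andbT //.
  by apply: contraTneq SE => ->; rewrite properE finset.sub0set andbF.
transitivity (\sum_(v : T | S \proper val v)
    \sum_(G in subset_complex A | [forall v in G, S \proper val v] && is_min v G)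
    \prod_(v in G) z (val v)); last by apply: eq_bigr => v; apply: sum_min.
rewrite (exchange_big_dep (fun G => (G \in subset_complex A)
   && [forall v in G, S \proper val v] && (G != finset.set0))) /=; last first.
  move=> v G Sv /and3P[-> -> /andP[vG _]]; apply/finset.set0Pn; by exists v.
apply: eq_bigr => G /andP[/andP[GD GS] G0].
have [v vm] := is_min_ex GD G0; rewrite [RHS](big_pred1 v) // => w.
rewrite GD GS /=; apply/andP/eqP => [[_ wm]|->]; first exact: is_min_uniq wm vm.
by split=> //; move/forall_inP: GS; apply; case/andP: vm.
Qed.
End Subset_complex.

(** * Positivity *)

Definition nonneg_coefs (N : {poly int}) := forall i : nat, 0 <= N`_i.

Lemma nonneg_coefs_add N N' :
  nonneg_coefs N -> nonneg_coefs N' -> nonneg_coefs (N + N').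
Proof. by move=> hN hN' i; rewrite coefD addr_ge0. Qed.

Lemma nonneg_coefs_mul N N' :
  nonneg_coefs N -> nonneg_coefs N' -> nonneg_coefs (N * N').
Proof. by move=> hN hN' i; rewrite coefM sumr_ge0 // => j _; rewrite mulr_ge0. Qed.

Lemma nonneg_coefsXn n : nonneg_coefs 'X^n.
Proof. by move=> i; rewrite coefXn; case: eqP. Qed.

Lemma nonneg_coefs_sum (I : Type) (r : seq I) (P : pred I) (F : I -> {poly int}) :
  (forall i, P i -> nonneg_coefs (F i)) -> nonneg_coefs (\sum_(i <- r | P i) F i).
Proof.
move=> FP; apply: (big_ind nonneg_coefs) => //; last exact: nonneg_coefs_add.
by move=> i; rewrite coef0.
Qed.

Section Positivity.
Variables (R : realType) (A : finType) (d : {set A} -> nat) (H : R -> {set A} -> R).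
Hypothesis d_gt0 : forall E, E != [set: A]%SET -> (0 < d E)%N.
Hypothesis HE : forall q, 1 < q -> sums_proper_chains (fun E => (q ^+ d E - 1)^-1) (H q).
Implicit Types (S E B : {set A}) (a b : A) (q : R).

Let M := (\prod_(E : {set A} | E != [set: A]%SET) d E)%N.

Let M_gt0 : (0 < M)%N.
Proof. exact: prodn_cond_gt0. Qed.

Let d_dvdM E : E != [set: A]%SET -> (d E %| M)%N.
Proof. by move=> ET; rewrite /M (bigD1 E) //= dvdn_mulr. Qed.

(** One numerator serves for all [q], and [n] fixes the power of the common denominator, so sums
    need no further reduction. *)
Definition nonneg_over n (h : R -> R) := exists2 N : {poly int}, nonneg_coefs N &
  forall q, 1 < q -> h q = (map_poly intr N).[q] / (q ^+ M - 1) ^+ n.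

Let pow_sub1_neq0 (q : R) n : 1 < q -> (0 < n)%N -> q ^+ n - 1 != 0.
Proof. by move=> q1 n0; rewrite subr_eq0 gt_eqF // exprn_egt1 // -lt0n. Qed.

Let nonneg_over0 n : nonneg_over n (fun=> 0).
Proof.
exists 0 => [i|q _]; first by rewrite coef0.
by rewrite rmorph0 horner0 mul0r.
Qed.

Let nonneg_over1 : nonneg_over 0 (fun=> 1).
Proof.
exists 'X^0 => [|q _]; first exact: nonneg_coefsXn.
by rewrite expr0 rmorph1 hornerC divr1.
Qed.

Let nonneg_over_eq n h g : nonneg_over n h -> (forall q, 1 < q -> g q = h q) ->
  nonneg_over n g.
Proof. by move=> [N N0 hN] gh; exists N => // q q1; rewrite gh ?hN. Qed.

Let nonneg_overD n h g : nonneg_over n h -> nonneg_over n g ->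
  nonneg_over n (fun q => h q + g q).
Proof.
move=> [N N0 hN] [N' N'0 gN']; exists (N + N'); first exact: nonneg_coefs_add.
by move=> q q1; rewrite hN // gN' // rmorphD hornerD mulrDl.
Qed.

Let nonneg_overM n m h g : nonneg_over n h -> nonneg_over m g ->
  nonneg_over (n + m) (fun q => h q * g q).
Proof.
move=> [N N0 hN] [N' N'0 gN']; exists (N * N'); first exact: nonneg_coefs_mul.
by move=> q q1; rewrite hN // gN' // rmorphM hornerM exprD invfM mulrACA.
Qed.

Let nonneg_over_sum n (I : Type) (r : seq I) (P : pred I) (h : I -> R -> R) :
  (forall i, P i -> nonneg_over n (h i)) ->
  nonneg_over n (fun q => \sum_(i <- r | P i) h i q).
Proof.
move=> hP; elim: r => [|i r IHr].
  by apply: nonneg_over_eq (nonneg_over0 n) _ => q _; rewrite big_nil.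
case: (boolP (P i)) => Pi.
  apply: nonneg_over_eq (nonneg_overD (hP i Pi) IHr) _ => q _.
  by rewrite big_cons Pi.
by apply: nonneg_over_eq IHr _ => q _; rewrite big_cons (negPf Pi).
Qed.

Let z E q : R := (q ^+ d E - 1)^-1.

(** Both 1/(q^d - 1) and, for [e] true, q^d/(q^d - 1) are brought over q^M - 1 by the geometric sum
    (q^M - 1)/(q^d - 1). *)
Let nonneg_over_z E (e : bool) : E != [set: A]%SET ->
  nonneg_over 1 (fun q => z E q + e%:R).
Proof.
move=> ET; have /dvdnP[k Mk] := d_dvdM ET.
exists ('X^(d E * e) * \sum_(i < k) 'X^(d E * i)).
  by apply: nonneg_coefs_mul; [|apply: nonneg_coefs_sum => i _]; exact: nonneg_coefsXn.
move=> q q1; have dq := pow_sub1_neq0 q1 (d_gt0 ET).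
rewrite rmorphM rmorph_sum hornerM horner_sum rmorphXn /= map_polyX hornerXn.
under eq_bigr do rewrite rmorphXn /= map_polyX hornerXn exprM.
have ME : q ^+ M - 1 = (q ^+ d E - 1) * \sum_(i < k) (q ^+ d E) ^+ i.
  by rewrite -subrX1 -exprM mulnC -Mk.
have := pow_sub1_neq0 q1 M_gt0; rewrite expr1 ME /z exprM.
rewrite mulf_eq0 negb_or => /andP[_ s0].
by case: e; rewrite ?expr1 ?expr0 ?mulr1n ?mulr0n; field; rewrite dq ?s0.
Qed.

(** The total weight of the chains with least set [E]; the value 1 at the full set stands for the
    empty chain. *)
Let K E q : R := if E == [set: A]%SET then 1 else z E q * H q E.

(* The sets strictly above S are split according to the largest (for the order
   of enum) element a of E :\: S; this refines chains by the descents of the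
   permutations of A extending them. *)
Let top S a E := [&& S \subset E, a \in (E :\: S)%SET &
  [forall b in (E :\: S)%SET, (enum_rank b <= enum_rank a)%N]].

Let f S a q : R := \sum_(E | top S a E) K E q.

Let H_sum S q : 1 < q -> S != [set: A]%SET -> H q S = \sum_(a | a \notin S) f S a q.
Proof.
move=> q1 ST; rewrite HE //.
transitivity (\sum_(E : {set A} | S \proper E) K E q).
  rewrite [RHS](bigD1 [set: A]%SET) ?finset.properT //= /K eqxx; congr (_ + _).
  by apply: eq_bigr => E /andP[_ /negPf->].
rewrite /f (exchange_big_dep (fun E => S \proper E)) /=; last first.
  move=> a E aS /and3P[SE]; rewrite finset.in_setD => /andP[_ aE] _.
  by apply/properP; split=> //; exists a.
apply: eq_bigr => E /properP[SE [a0 a0E a0S]].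
have a0D : a0 \in (E :\: S)%SET by rewrite finset.in_setD a0E a0S.
case: (arg_maxnP (fun b : A => (enum_rank b : nat)) a0D) => a aD am.
have aD' : a \in (E :\: S)%SET := aD.
rewrite [RHS](big_pred1 a) // => b; rewrite /top SE /=.
apply/and3P/eqP => [[_ bD /forall_inP bm]|->].
  apply/enum_rank_inj/val_inj/eqP; rewrite eqn_leq.
  by apply/andP; split; [exact: am|exact: bm].
split=> //; last by apply/forall_inP => c; exact: am.
by move: aD'; rewrite finset.in_setD => /andP[].
Qed.

(** Either [E] is [S] with [a] added, or the largest further element [b] is smaller than [a]: within
    a block, elements are added in decreasing order. *)
Let f_rec S a q : a \notin S ->
  f S a q = K (a |: S)%SET q +
    \sum_(b | (b \notin (a |: S)%SET) && (enum_rank b < enum_rank a)%N) f (a |: S)%SET b q.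
Proof.
move=> aS; set B := (a |: S)%SET.
have topB : top S a B.
  apply/and3P; split; first exact: finset.subsetUr.
    by rewrite !inE eqxx aS.
  apply/forall_inP => b; rewrite !inE => /andP[/negPf bS]; rewrite bS orbF.
  by move/eqP->.
rewrite {1}/f (bigD1 B) //=; congr (_ + _).
rewrite /f (exchange_big_dep (fun E => top S a E && (E != B))) /=; last first.
  move=> b E /andP[bB ba] /and3P[BE bD /forall_inP bm].
  have SB : S \subset B by apply: finset.subsetUr.
  have aB : a \in B by rewrite !inE eqxx.
  apply/andP; split; last first.
    by apply: contraTneq bD => ->; rewrite finset.setDv inE.
  apply/and3P; split; first exact: fintype.subset_trans BE.
    by rewrite finset.in_setD aS (fintype.subsetP BE).
  apply/forall_inP => c; rewrite finset.in_setD => /andP[cS cE].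
  case: (eqVneq c a) => [->//|ca]; apply: leq_trans (ltnW ba).
  by apply: bm; rewrite finset.in_setD cE andbT !inE negb_or ca.
apply: eq_bigr => E /andP[/and3P[SE aD /forall_inP am] EB].
have aE : a \in E by move: aD; rewrite finset.in_setD => /andP[].
have BE : B \subset E by rewrite finset.subUset finset.sub1set aE.
have [b0 b0D] : exists b, b \in (E :\: B)%SET.
  by apply/finset.set0Pn; rewrite finset.setD_eq0; apply: contra EB => EB; rewrite finset.eqEsubset EB.
case: (arg_maxnP (fun b : A => (enum_rank b : nat)) b0D) => b bD bm.
have bD' : b \in (E :\: B)%SET := bD.
rewrite [RHS](big_pred1 b) // => c; rewrite /top BE /=.
apply/andP/eqP => [[/andP[cB ca] /andP[cD /forall_inP cm]]|->].
  apply/enum_rank_inj/val_inj/eqP; rewrite eqn_leq.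
  by apply/andP; split; [exact: bm|exact: cm].
have /andP[bB bE] : (b \notin B) && (b \in E) by rewrite -finset.in_setD.
split; last by apply/andP; split=> //; apply/forall_inP => e; exact: bm.
rewrite bB /=.
have : b \notin B := bB; rewrite !inE negb_or => /andP[ba bS].
rewrite ltn_neqAle am ?finset.in_setD ?bS // andbT.
by apply: contraNneq ba => /val_inj/enum_rank_inj->.
Qed.

(** For [B] equal to [S] with [a] added, expanding H(B) by [H_sum] gives f(S,a) as the sum over b
    outside B of (z(B) + [b < a]) f(B,b). Thus every added element but the last brings one factor
    over q^M - 1. *)
Let nonneg_over_f S a : a \notin S -> nonneg_over #|~: S|.-1 (f S a).
Proof.
have [n] := ubnP #|~: S|%SET; elim: n => // n IHn in S a *; rewrite ltnS => Sn aS.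
set B := (a |: S)%SET.
have cB : #|~: S|%SET = #|~: B|.+1%SET.
  rewrite (finset.cardsD1 a) finset.in_setC aS add1n; congr (_.+1); apply: eq_card => b.
  by rewrite !inE negb_or.
have [BT|BT] := eqVneq B [set: A]%SET.
  rewrite cB BT finset.setCT finset.cards0.
  apply: nonneg_over_eq nonneg_over1 _ => q q1.
  rewrite f_rec // -/B /K BT eqxx big1 ?addr0 // => b.
  by rewrite inE.
have Bc : (0 < #|~: B|%SET)%N.
  by rewrite card_gt0; apply: contra BT => /eqP h; rewrite -[B]finset.setCK h finset.setC0.
rewrite cB /= -[#|_|%SET](prednK Bc) -add1n.
pose e b := (enum_rank b < enum_rank a)%N.
apply: (@nonneg_over_eq _
  (fun q => \sum_(b | b \notin B) (z B q + (e b)%:R) * f B b q)).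
  apply: nonneg_over_sum => b bB; apply: nonneg_overM; first exact: nonneg_over_z.
  by apply: IHn => //; rewrite -cB.
move=> q q1; rewrite f_rec // -/B /K (negPf BT) H_sum // mulr_sumr.
rewrite big_mkcondr -big_split; apply: eq_bigr => b _ /=.
by rewrite mulrDl; congr (_ + _); rewrite /e; case: ifP; rewrite ?mul1r ?mul0r.
Qed.

Lemma chains_rational_nonneg : exists N D : {poly int}, nonneg_coefs N /\
  forall q, 1 < q -> (map_poly intr D).[q] != 0 /\
    H q finset.set0 = (map_poly intr N).[q] / (map_poly intr D).[q].
Proof.
suff [n [N N0 HN]] : exists n, nonneg_over n (H^~ finset.set0).
  exists N, (('X^M - 1) ^+ n); split=> // q q1.
  have -> : (map_poly intr (('X^M - 1) ^+ n)).[q] = (q ^+ M - 1) ^+ n :> R.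
    by rewrite rmorphXn rmorphB rmorphXn /= map_polyX rmorph1 !hornerE.
  by rewrite expf_neq0 ?pow_sub1_neq0 // HN.
(* If [A] is empty, the only chain is the empty one. *)
have [AT|AT] := eqVneq (finset.set0 : {set A}) [set: A]%SET.
  exists 0%N; apply: nonneg_over_eq nonneg_over1 _ => q q1.
  rewrite HE // big1 ?addr0 // => E; rewrite AT => /andP[TE /negP[]].
  by rewrite -finset.subTset; exact: proper_sub.
exists #|~: (finset.set0 : {set A})|%SET.-1.
apply: (@nonneg_over_eq _ (fun q => \sum_(a | a \notin (finset.set0 : {set A})) f finset.set0 a q)).
  by apply: nonneg_over_sum => a; exact: nonneg_over_f.
by move=> q q1; rewrite H_sum.
Qed.

End Positivity.

(** * The Betti weights and the conclusion *)

Section Betti_weights.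
Variables (R : realType) (Q : quiver) (q : R).
Hypotheses (hQ : two_connected Q) (q1 : 1 < q).
Let b : int := betti [set: arrow Q]%SET.
Let w (E : {set arrow Q}) : R := q ^ (- (b - betti E)).

(** The exponent as a natural number; the absolute value changes nothing because [betti] is
    monotone. *)
Definition betti_drop (E : {set arrow Q}) : nat := `|betti [set: arrow Q]%SET - betti E|%N.

Lemma betti_drop_gt0 E : E != [set: arrow Q]%SET -> (0 < betti_drop E)%N.
Proof. by move=> ET; rewrite absz_gt0 subr_eq0 gt_eqF // betti_lt_setT. Qed.

Lemma betti_weightE E : w E = (q ^+ betti_drop E)^-1.
Proof.
rewrite /w -invr_expz exprnP /betti_drop gez0_abs // subr_ge0.
exact/betti_mono/finset.subsetT.
Qed.

Lemma betti_weight_lt1 E : E != [set: arrow Q]%SET -> 0 <= w E < 1.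
Proof.
move=> ET; have q0 : 0 < q by exact: lt_trans q1.
rewrite betti_weightE invr_ge0 exprn_ge0 ?ltW //=.
by rewrite invf_lt1 ?exprn_gt0 // exprn_egt1 // -lt0n betti_drop_gt0.
Qed.

Lemma betti_weight_odds E : E != [set: arrow Q]%SET ->
  w E / (1 - w E) = (q ^+ betti_drop E - 1)^-1.
Proof.
move=> ET; have q0 : q ^+ betti_drop E != 0.
  by rewrite expf_neq0 // gt_eqF // (lt_trans _ q1).
have q10 : q ^+ betti_drop E - 1 != 0.
  by rewrite subr_eq0 gt_eqF // exprn_egt1 // -lt0n betti_drop_gt0.
by rewrite betti_weightE; field; rewrite q0 q10.
Qed.

Lemma Hilb_bettiE : Hilb_betti Q q =
  chains_above (fun E : {set arrow Q} => (q ^+ betti_drop E - 1)^-1) finset.set0.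
Proof.
have vT (v : proper_nonempty (arrow Q)) : val v != [set: arrow Q]%SET.
  by have /andP[] := valP v.
rewrite chains_above0 /Hilb_betti HilbE.
- by apply: eq_bigr => G _; apply: eq_bigr => v _; exact: betti_weight_odds.
- by move=> v; exact: betti_weight_lt1.
- exact: order_complex_down.
Qed.

End Betti_weights.

Lemma normalized_count_cvg (R : realType) (Q : quiver) (F : finFieldType)
    (q : R := #|F|%:R) (b := betti [set: arrow Q]%SET) :
  two_connected Q -> (finset.set0 : {set arrow Q}) != [set: arrow Q]%SET ->
  (normalized_count R Q F @ \oo -->
     (1 - q^-1) ^ b / (1 - q ^ (- b)) * Hilb_betti Q q)%classic.
Proof.
move=> hQ AT; have /andP[cT _] := hQ.
have q1 : 1 < q by rewrite ltr1n (cardD1 0) (cardD1 1) !inE oner_eq0.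
pose w (E : {set arrow Q}) := q ^ (- (b - betti E)).
pose phi (E : {set arrow Q}) := (connected_graph E)%:R * (1 - q^-1) ^ betti E.
have : ((fun n => chain_sum w phi n finset.set0) @ \oo -->
    phi [set: arrow Q]%SET * Hilb_betti Q q / (1 - w finset.set0))%classic.
  rewrite Hilb_bettiE //; apply: chain_sum_cvg => //.
  - by move=> E; exact: betti_weight_lt1.
  - by rewrite /w subrr.
  move=> S; rewrite chains_aboveE; congr (_ + _); apply: eq_bigr => E /andP[_ ET].
  by rewrite betti_weight_odds.
(* The chain formula for the count is available from [alpha = 1] on, so both sequences are shifted
   by one. *)
rewrite -cvg_shiftS /phi cT mul1r /w betti0 subr0 mulrAC => lim.
rewrite -cvg_shiftS /=; under eq_cvg do rewrite normalized_count_chain //.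
exact: lim.
Qed.

Theorem theorem3 (R : realType) (Q : quiver) (hQ : two_connected Q) :
  (forall F : finFieldType,
     let q : R := #|F|%:R in
     let b : int := betti [set: arrow Q]%SET in
     cvgn (normalized_count R Q F) /\
     (b != 0 ->
      A_limit R Q F = (1 - q^-1) ^ b / (1 - q ^ (- b)) * Hilb_betti Q q)) /\
  (exists N D : {poly int},
     (forall i : nat, 0 <= N`_i) /\
     forall q : R, 1 < q ->
       (map_poly intr D).[q] != 0 /\
       Hilb_betti Q q = (map_poly intr N).[q] / (map_poly intr D).[q]).
Proof.
split=> [F q b|].
  (* Without arrows b(Q) = 0, the denominator 1 - q^-b(Q) vanishes, and the count is constant from
     [alpha = 1] on. *)
  have [T0|AT] := eqVneq (finset.set0 : {set arrow Q}) [set: arrow Q]%SET.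
    split; last by rewrite /b -T0 betti0 eqxx.
    have /andP[cT _] := hQ.
    apply/cvg_ex; exists ((connected_graph [set: arrow Q]%SET)%:R * (1 - q^-1) ^ b).
    rewrite -cvg_shiftS /=.
    under eq_cvg do rewrite normalized_count_chain // T0 chain_sum_setT ?subrr //.
    exact: cvg_cst.
  have lim := @normalized_count_cvg R Q F hQ AT.
  by split=> [|_]; [apply/cvg_ex; eexists; exact: lim|apply/cvg_lim => //; exact: lim].
(* The positivity argument is applied to the chain sums, with exponents that are positive by
   2-connectedness. *)
have [N [D [N0 ND]]] := @chains_rational_nonneg R (arrow Q) (@betti_drop Q)
  (fun q => chains_above (fun E => (q ^+ betti_drop E - 1)^-1))
  (betti_drop_gt0 hQ) (fun q _ => chains_aboveE _).
exists N, D; split=> // q q1; have [Dq Hq] := ND q q1.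
by split=> //; rewrite Hilb_bettiE.
Qed.
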